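(* Let $\nu$ be a diffuse (i.e., non-atomic) probability measure on a measurable space $(E,\mathcal{E})$. Let $\{\kappa_\theta:\theta\in\Theta\}$ be a canonical non-negative power series (NNPS) family with coefficients $a_k$ and normalizing function $g$, satisfying additionally $a_1>0$. Then the relation $$g\big((at+b)\theta\big)=g(b\theta)\,g\big(h_a(\theta)\,t\big),\qquad b=1-a,$$ holds (meaning that for every $0<a\le 1$ there exists a mapping $h_a:\Theta\to\Theta$ for which this identity holds for all $\theta\in\Theta$ and all $t\in[0,1]$) if and only if $$\log g(\theta)=\theta\qquad\text{or}\qquad \log g(\theta)=\pm c\,\log(1\pm\theta),$$ where $c>0$ (upper signs taken together, lower signs taken together).
   Context: NNPS family: $\kappa_\theta$, with parameter $\theta>0$ in a parameter set $\Theta$, is the law of a random variable $K$ with values in $\{0,1,2,\dots\}$ given by $\mathbb{P}(K=k)=p_k(\theta)=a_k\theta^k/g(\theta)$, where $a_k\ge 0$, $g(\theta)=\sum_{k\ge 0}a_k\theta^k$ is the normalizing series, and $p_0(\theta)>0$. The family is called canonical if $a_0=1$. Origin of the relation: let $X_1,X_2,\dots$ be iid with law $\nu$ on $(E,\mathcal{E})$, independent of $K\sim\kappa_\theta$, and for $A\in\mathcal{E}$ with $a=\nu(A)>0$ let $N(A)=\sum_{i=1}^{K}\mathbb{I}_A(X_i)$, where $\mathbb{I}_A$ is the indicator function of $A$. Write $\psi_\theta(t)=\mathbb{E}\,t^K$ for the probability generating function of $K$; then $N(A)$ has probability generating function $\psi_\theta(at+1-a)$. The family $\{\kappa_\theta\}$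 is called strongly invariant (a ''bone'') if for any $0<a\le 1$ there exists a mapping $h_a:\Theta\to\Theta$ such that $\psi_\theta(at+1-a)=\psi_{h_a(\theta)}(t)$. For a canonical NNPS family this condition takes the form of the relation for $g$ in the claim.
   Formalization: The forms are taken up to a scale λ>0 (log g = λθ or ±c log(1±λθ)), since g=exp(2θ) satisfies the relation; and Θ is assumed closed downwards in (0,∞), since for Θ={1}, g=exp no map h_a:Θ→Θ exists. *)

(* Defs.v *)
From mathcomp Require Import all_boot all_order all_algebra.
From mathcomp Require Import all_classical all_reals all_analysis.

Set Implicit Arguments.
Unset Strict Implicit.
Unset Printing Implicit Defensive.

Import Order.TTheory GRing.Theory Num.Theory.
Import numFieldNormedType.Exports.

Local Open Scope classical_set_scope.
Local Open Scope ring_scope.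

(* Singletons need not be measurable in a general measurable space, hence the
   definition by splitting of sets of positive measure. *)
Definition diffuse (R : realType) (d : measure_display) (E : measurableType d)
    (nu : set E -> \bar R) : Prop :=
  forall A : set E, measurable A -> (0 < nu A)%E ->
    exists B : set E, [/\ measurable B, B `<=` A, (0 < nu B)%E
                        & (nu B < nu A)%E].

(* [limn] is total: the value is meaningful only where the series converges. *)
Definition gseries (R : realType) (a : nat -> R) (theta : R) : R :=
  limn (pseries a theta).

(* Only the values of [kappa] on [Theta] are constrained. *)
Definition is_NNPS (R : realType) (a : nat -> R) (Theta : set R)
    (kappa : R -> probability nat R) : Prop :=
  (forall k, 0 <= a k) /\
  (forall theta, Theta theta ->
    [/\ 0 < theta,
        cvgn (pseries a theta),
        forall k, kappa theta [set k]
                  = (a k * theta ^+ k / gseries a theta)%:E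
      & (0 < kappa theta [set 0%N])%E]).

Definition is_canonical (R : realType) (a : nat -> R) : Prop := a 0%N = 1.

(* The set is an interval with left end point 0.  Such are the natural set of
   all parameters (lemma below) and each of its truncations ]0, r[ or ]0, r].
   The condition cannot be dropped: for g = exp, the relation forces
   h_p(theta) = p * theta, so that Theta must contain p * theta for every
   0 < p <= 1. *)
Definition is_parameter_set (R : realType) (Theta : set R) : Prop :=
  forall theta, Theta theta ->
    forall theta', 0 < theta' <= theta -> Theta theta'.

Lemma natural_parameter_set (R : realType) (a : nat -> R)
    (a_ge0 : forall k, 0 <= a k) :
  is_parameter_set [set theta | 0 < theta /\ cvgn (pseries a theta)].
Proof.
move=> x [x0 cx] y /andP[y0 yx]; split => //.
apply: (series_le_cvg _ _ _ cx) => n.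
- by rewrite mulr_ge0// exprn_ge0// ltW.
- by rewrite mulr_ge0// exprn_ge0// ltW.
- by rewrite ler_wpM2l// lerXn2r// nnegrE ltW.
Qed.

(* Here [p] is the mass of the thinning set, [h] is the mapping h_p; it is a
   total function on R which maps Theta into Theta. *)
Definition bone_relation (R : realType) (a : nat -> R) (Theta : set R) : Prop :=
  forall p : R, 0 < p <= 1 ->
    exists h : R -> R,
      (forall theta, Theta theta -> Theta (h theta)) /\
      (forall theta t, Theta theta -> 0 <= t <= 1 ->
        gseries a ((p * t + (1 - p)) * theta)
        = gseries a ((1 - p) * theta) * gseries a (h theta * t)).

(* Main.v *)
Require Import Defs.
From mathcomp Require Import all_boot all_order all_algebra.
From mathcomp Require Import all_classical all_reals all_analysis.
From mathcomp Require Import ring lra.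

(** For a real [s] let [qlog s] be the primitive of [x |-> 1 / (1 + s * x)] that
    vanishes at [0]: it is [x] for [s = 0] and [ln (1 + s * x) / s] otherwise.
    The three forms of [ln g] in the theorem are exactly [ln g = k * qlog s]
    with [k > 0], for [s = 0], [s > 0] and [s < 0], so one argument treats all
    of them.

    Sufficiency.  [qlog s] turns the law [x (+) y = x + y + s * x * y], for which
    [1 + s * (x (+) y) = (1 + s * x) * (1 + s * y)], into addition ([qlogD]).
    With [b = 1 - p] one has [(p * t + b) * x = (b * x) (+) (h * t)] for the
    mapping [h = p * x / (1 + s * b * x)], so [ln g = k * qlog s] gives the
    relation ([bone_of_ln_gseries]).

    Necessity.  At the point [x = b * theta] the relation says that
    [g (x + u * t) = g x * g (h * t)] for [t] in [[0, 1]], with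
    [u = theta - x].  The first two derivatives at [t = 0] give
    [u * g' x = g x * h * g' 0] and [u^2 * g'' x = g x * h^2 * g'' 0]; the
    elimination of the unknown [h] leaves the differential equation
    [g'(0)^2 * g * g'' = g''(0) * g'^2] ([gseries_ODE]).  It says that [g / g']
    has a constant derivative, so [g'/g = g'(0) / (1 + s * x)] with
    [s = g'(0) - g''(0) / g'(0)], and [ln g = g'(0) * qlog s]
    ([ln_gseries_of_ODE]).  This covers the points below some element of the
    parameter set.  A largest element [r], where the series need not be
    differentiable, is reached through the relation itself, which expresses
    [g r] by values of [g] at two smaller points ([ln_gseries_of_bone]). *)

Set Implicit Arguments.
Unset Strict Implicit.
Unset Printing Implicit Defensive.

Import Order.TTheory GRing.Theory Num.Theory.
Import numFieldNormedType.Exports.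

Local Open Scope classical_set_scope.
Local Open Scope ring_scope.

(** * Power series with nonnegative coefficients *)

(** The mean value estimate for a power.  It lets the differences of the terms
    of a power series dominate the terms of its derived series. *)
Lemma expr_diff_ge (R : realDomainType) (x y : R) (n : nat) : 0 <= y <= x ->
  n.+1%:R * y ^+ n * (x - y) <= x ^+ n.+1 - y ^+ n.+1.
Proof.
move=> /andP[y0 yx]; elim: n => [|n IHn]; first by rewrite expr0 !expr1; lra.
have yn0 : 0 <= y ^+ n.+1 by exact: exprn_ge0.
have yxn : y ^+ n.+1 <= x ^+ n.+1 by rewrite lerXn2r// nnegrE; lra.
rewrite (exprS x) (exprS y n.+1) -[n.+2%:R]natr1.
have -> : (n.+1%:R + 1) * y ^+ n.+1 * (x - y) =
    y * (n.+1%:R * y ^+ n * (x - y)) + y ^+ n.+1 * (x - y).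
  by rewrite exprS; ring.
have := ler_wpM2l y0 IHn; nra.
Qed.

(** [(n + 1) * f (n + 1) * y ^ n <= f (n + 1) * x ^ (n + 1) / (x - y)], so the
    derived series at [y] is dominated by a multiple of the shifted series
    at [x]. *)
Lemma is_cvg_pseries_diffs (R : realType) (f : nat -> R) (x y : R) :
  (forall n, 0 <= f n) -> cvgn (pseries f x) -> 0 <= y < x ->
  cvgn (pseries (pseries_diffs f) y).
Proof.
move=> f0 fx /andP[y0 yx]; have xy0 : 0 < x - y by rewrite subr_gt0.
have x0 : 0 <= x by lra.
pose v := (x - y)^-1 *: (fun n => f n.+1 * x ^+ n.+1) : nat -> R.
apply: (@series_le_cvg _ _ v).
- by move=> n; rewrite mulr_ge0// ?exprn_ge0// mulr_ge0.
- move=> n; rewrite /v /= mulr_ge0 ?invr_ge0 ?(ltW xy0)//.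
  by rewrite mulr_ge0// exprn_ge0.
- move=> n; rewrite /v /= /pseries_diffs ler_pdivlMl//.
  rewrite [leLHS](_ : _ = f n.+1 * (n.+1%:R * y ^+ n * (x - y))); last by ring.
  rewrite ler_wpM2l//; apply: (le_trans (expr_diff_ge _ _)).
    by rewrite y0 ltW.
  by rewrite gerBl exprn_ge0.
apply: is_cvg_seriesZ.
have : cvgn ([sequence pseries f x n.+1]_n : nat -> R).
  by apply/cvg_ex; exists (limn (pseries f x)); rewrite cvg_shiftS.
rewrite (_ : [sequence pseries f x n.+1]_n =
  cst (f 0%N) + series (fun n => f n.+1 * x ^+ n.+1)).
  move=> h; have /is_cvgD/(_ h) : cvgn (cst (- f 0%N) : nat -> R).
    exact: is_cvg_cst.
  by rewrite addrA -[cst _ + cst _]/(cst (- f 0%N + f 0%N)) addNr add0r.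
apply/funext => n.
by rewrite /pseries /series /= big_nat_recl// expr0 mulr1 /cst fctE.
Qed.

(** Termwise differentiation asks for a single radius [k2 > x] at which the
    series and its first two derived series all converge; each derivation costs
    a bit of radius, hence the points [x < k2 < k1 < r]. *)
Lemma is_derive_gseries (R : realType) (f : nat -> R) (r x : R) :
  (forall n, 0 <= f n) -> cvgn (pseries f r) -> 0 <= x < r ->
  is_derive x 1 (gseries f) (gseries (pseries_diffs f) x).
Proof.
move=> f0 fr /andP[x0 xr].
have df0 n : 0 <= pseries_diffs f n by rewrite mulr_ge0.
pose k1 := (x + r) / 2; pose k2 := (x + k1) / 2.
have [xk1 k1r] : x < k1 /\ k1 < r by rewrite /k1; lra.
have [xk2 k2k1] : x < k2 /\ k2 < k1 by rewrite /k2; lra.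
apply: (@pseries_snd_diffs _ _ k2).
- by apply: is_cvg_pseries_inside fr _; rewrite !ger0_norm; lra.
- by apply: is_cvg_pseries_diffs fr _ => //; lra.
- apply: (@is_cvg_pseries_diffs _ _ k1) => //; last by lra.
  by apply: is_cvg_pseries_diffs fr _ => //; lra.
- by rewrite !ger0_norm; lra.
Qed.

Lemma gseries0 (R : realType) (f : nat -> R) : gseries f 0 = f 0%N.
Proof.
apply: lim_near_cst => //; near=> n.
have -> : n = n.-1.+1 by rewrite prednK//; near: n; exact: nbhs_infty_gt.
rewrite /pseries /series /= big_nat_recl// expr0 mulr1 big1 ?addr0// => i _.
by rewrite expr0n mulr0.
Unshelve. all: by end_near. Qed.

Lemma gseries_ge (R : realType) (f : nat -> R) (x : R) (n : nat) :
  (forall n, 0 <= f n) -> cvgn (pseries f x) -> 0 <= x ->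
  pseries f x n <= gseries f x.
Proof.
move=> f0 fx x0; apply: nondecreasing_cvgn_le => //.
by apply: nondecreasing_series => k _ _; rewrite mulr_ge0// exprn_ge0.
Qed.

Lemma ler_gseries (R : realType) (f : nat -> R) (x y : R) :
  (forall n, 0 <= f n) -> cvgn (pseries f x) -> cvgn (pseries f y) ->
  0 <= x <= y -> gseries f x <= gseries f y.
Proof.
move=> f0 fx fy /andP[x0 xy]; apply: ler_lim => //.
apply: nearW => n; apply: ler_sum => i _.
by rewrite ler_wpM2l// lerXn2r// nnegrE; lra.
Qed.

Lemma cvg_pseries_le (R : realType) (f : nat -> R) (x z : R) :
  cvgn (pseries f x) -> 0 <= z <= x -> cvgn (pseries f z).
Proof.
move=> fx /andP[z0]; rewrite le_eqVlt => /predU1P[->//|zx].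
by apply: is_cvg_pseries_inside fx _; rewrite !ger0_norm; lra.
Qed.

Lemma gseries_ge_affine (R : realType) (f : nat -> R) (x : R) :
  (forall n, 0 <= f n) -> cvgn (pseries f x) -> 0 <= x ->
  f 0%N + f 1%N * x <= gseries f x.
Proof.
move=> f0 fx x0; have := gseries_ge 2 f0 fx x0.
by rewrite /pseries /series /= !big_nat_recr//= big_geq// add0r expr0 mulr1 expr1.
Qed.

(** * Functions of a real variable *)

(** Both derivatives are limits of the difference quotients from the right,
    and these coincide.  A one-sided hypothesis is needed because the relation
    holds only for [t >= 0] and is differentiated at [t = 0]. *)
Lemma eq_is_derive_right (R : realType) (u v : R -> R) (x y du dv : R) :
  is_derive x 1 u du -> is_derive x 1 v dv -> x < y ->
  (forall t, x <= t < y -> u t = v t) -> du = dv.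
Proof.
move=> hu hv xy uv.
have [/cvg_dnbhs_at_right D E] := is_deriveB hu hv.
apply/eqP; rewrite -subr_eq0 -E; apply/eqP.
suff H : (0 : R) @[_ --> (0:R)^'+] --> 'D_1 (u - v) x.
  by apply: cvg_unique H _ => //; exact: cvg_cst.
apply: cvg_trans D.
apply: near_eq_cvg; near=> h.
have h0 : 0 < h by [].
have hy : h < y - x by near: h; apply: nbhs_right_lt; rewrite subr_gt0.
have w0 t : x <= t < y -> (u - v) t = 0.
  by rewrite fctE => /uv ->; rewrite subrr.
rewrite /= [h%:A]mulr1 !w0 ?subrr ?scaler0//; lra.
Unshelve. all: by end_near. Qed.

Lemma eq_primitive (R : realType) (u v d : R -> R) (x y : R) : x <= y ->
  (forall t, x <= t <= y -> is_derive t 1 u (d t)) ->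
  (forall t, x <= t <= y -> is_derive t 1 v (d t)) ->
  u x = v x -> u y = v y.
Proof.
move=> xy hu hv uvx.
have D t : x <= t <= y -> is_derive t 1 (u - v) 0.
  by move=> xty; rewrite -(subrr (d t)); apply: is_deriveB; [exact: hu|exact: hv].
have [||_ _] := @MVT_segment R (u - v) (fun=> 0) x y xy.
- by move=> t; rewrite in_itv/= => /andP[xt ty]; apply: D; rewrite !ltW.
- apply: derivable_within_continuous => t; rewrite in_itv/= => /D.
  by case.
by rewrite mul0r !fctE uvx subrr subr0 => /eqP; rewrite subr_eq0 => /eqP.
Qed.

Lemma is_derive_affine (R : realType) (F : R -> R) (x u t dF : R) :
  is_derive (x + u * t) 1 F dF -> is_derive t 1 (fun t => F (x + u * t)) (u * dF).
Proof.
move=> DF; have D : is_derive t 1 (fun t => x + u * t) u.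
  have := is_deriveD (is_derive_cst x t 1) (is_deriveZ u (is_derive_id t (1 : R))).
  by rewrite add0r [u *: _]mulr1.
by rewrite mulrC; exact: (@is_derive1_comp _ F (fun t => x + u * t)).
Qed.

Lemma is_derive_linear (R : realType) (F : R -> R) (u t dF : R) :
  is_derive (u * t) 1 F dF -> is_derive t 1 (fun t => F (u * t)) (u * dF).
Proof.
move=> DF; have := @is_derive_affine _ F 0 u t dF; rewrite add0r => /(_ DF).
by congr is_derive; apply/funext => y; rewrite add0r.
Qed.

(** * A one-parameter family of logarithms *)

(** The primitive of [x |-> 1 / (1 + s * x)] vanishing at [0], on the interval
    where [1 + s * x > 0]; the case [s = 0] is the limit of the other ones. *)
Definition qlog (R : realType) (s x : R) : R :=
  if s == 0 then x else ln (1 + s * x) / s.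

Lemma qlog0 (R : realType) (s : R) : qlog s 0 = 0.
Proof. by rewrite /qlog mulr0 addr0 ln1 mul0r if_same. Qed.

Lemma is_derive_qlog (R : realType) (s x : R) : 0 < 1 + s * x ->
  is_derive x 1 (qlog s) (1 + s * x)^-1.
Proof.
move=> sx0; rewrite /qlog; have [->|s0] := eqVneq s 0.
  by rewrite mul0r addr0 invr1; exact: is_derive_id.
have D : is_derive x 1 (fun y => 1 + s * y) s.
  have := is_deriveD (is_derive_cst (1 : R) x 1)
    (is_deriveZ s (is_derive_id x (1 : R))).
  by rewrite add0r [s *: _]mulr1.
have := is_deriveZ s^-1
    (@is_derive1_comp _ (@ln R) (fun y => 1 + s * y) _ _ _ (is_derive1_ln sx0) D).
rewrite /GRing.scale/= mulrCA mulVf// mulr1.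
by congr is_derive; apply/funext => y; rewrite mulrC.
Qed.

(** The argument on the left is the law [(+)] for which [x |-> 1 + s * x] is
    multiplicative. *)
Lemma qlogD (R : realType) (s x y : R) :
  0 < 1 + s * x -> 0 < 1 + s * y ->
  qlog s (x + y + s * x * y) = qlog s x + qlog s y.
Proof.
move=> sx0 sy0; rewrite /qlog; have [->|s0] := eqVneq s 0.
  by rewrite !mul0r addr0.
rewrite -mulrDl -lnM ?posrE//; congr (ln _ / s); ring.
Qed.

Lemma qlog_inj (R : realType) (s x y : R) :
  0 < 1 + s * x -> 0 < 1 + s * y -> qlog s x = qlog s y -> x = y.
Proof.
move=> sx0 sy0; rewrite /qlog; case: eqVneq => [//|s0].
move=> /(mulIf (invr_neq0 s0)) /ln_inj; rewrite !posrE => /(_ sx0 sy0).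
by move=> /addrI /(mulfI s0).
Qed.

(** * The differential equation of a bone *)

(** The identity in [t] is differentiated twice at [t = 0]; the two resulting
    equations determine [h] and [h ^ 2], and eliminating [h] gives the
    claim. *)
Lemma gseries_ODE (R : realType) (f : nat -> R) (x u h : R) :
  (forall n, 0 <= f n) -> 0 <= x -> 0 < u -> 0 < h ->
  cvgn (pseries f (x + u)) -> cvgn (pseries f h) ->
  (forall t, 0 <= t <= 1 ->
    gseries f (x + u * t) = gseries f x * gseries f (h * t)) ->
  let f' := pseries_diffs f in let f'' := pseries_diffs f' in
  f' 0%N ^+ 2 * (gseries f x * gseries f'' x) = f'' 0%N * gseries f' x ^+ 2.
Proof.
move=> f0 x0 u0 h0 fxu fh E f' f''.
have f'0 n : 0 <= f' n by rewrite mulr_ge0.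
have f'xu : cvgn (pseries f' (x + u / 2)).
  by apply: is_cvg_pseries_diffs fxu _ => //; lra.
have f'h : cvgn (pseries f' (h / 2)).
  by apply: is_cvg_pseries_diffs fh _ => //; lra.
(* The first derivative is needed on a whole interval, since it has to be
   differentiated once more. *)
have E1 t : 0 <= t < 1 ->
    u * gseries f' (x + u * t) = gseries f x * (h * gseries f' (h * t)).
  move=> /andP[t0 t1].
  have Dl : is_derive t 1 (fun t => gseries f (x + u * t))
      (u * gseries f' (x + u * t)).
    by apply/is_derive_affine/(is_derive_gseries f0 fxu); nra.
  have Dr : is_derive t 1 (fun t => gseries f (h * t)) (h * gseries f' (h * t)).
    by apply/is_derive_linear/(is_derive_gseries f0 fh); nra.
  apply: (eq_is_derive_right Dl (is_deriveZ (gseries f x) Dr) t1) => y yt.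
  by apply: E; lra.
have E2 : u * (u * gseries f'' x) = gseries f x * (h * (h * f'' 0%N)).
  have Dl : is_derive (0 : R) 1 (fun t => gseries f' (x + u * t))
      (u * gseries f'' (x + u * 0)).
    by apply/is_derive_affine/(is_derive_gseries f'0 f'xu); lra.
  have Dr : is_derive (0 : R) 1 (fun t => gseries f' (h * t))
      (h * gseries f'' (h * 0)).
    by apply/is_derive_linear/(is_derive_gseries f'0 f'h); lra.
  have := eq_is_derive_right (is_deriveZ u Dl)
    (is_deriveZ (gseries f x) (is_deriveZ h Dr)) ltr01 E1.
  by rewrite !mulr0 addr0 gseries0.
have := E1 0; rewrite !mulr0 addr0 gseries0 lexx ltr01 => /(_ isT) {}E1.
(* [E1] and [E2] determine [u * g'] and [u ^ 2 * g''], whence the factor. *)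
apply: (mulfI (_ : u ^+ 2 != 0)); first by rewrite expf_neq0// gt_eqF.
rewrite [LHS](_ : _ = f' 0%N ^+ 2 * gseries f x * (u * (u * gseries f'' x))).
  rewrite [RHS](_ : _ = f'' 0%N * (u * gseries f' x) ^+ 2); last by ring.
  by rewrite E1 E2; ring.
by ring.
Qed.

(** By the equation, [(g / g')' = 1 - g * g'' / g' ^ 2] is the constant
    [1 - g''(0) / g'(0) ^ 2 = s / g'(0)].  So [g / g'] is affine; as [g] and [g']
    are positive, this also yields [1 + s * x > 0]. *)
Lemma ln_gseries_of_ODE (R : realType) (f : nat -> R) (r : R) :
  (forall n, 0 <= f n) -> f 0%N = 1 -> 0 < f 1%N -> cvgn (pseries f r) ->
  let f' := pseries_diffs f in let f'' := pseries_diffs f' in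
  (forall x, 0 <= x < r ->
    f' 0%N ^+ 2 * (gseries f x * gseries f'' x) = f'' 0%N * gseries f' x ^+ 2) ->
  let s := f 1%N - f'' 0%N / f 1%N in
  forall x, 0 <= x < r ->
    0 < 1 + s * x /\ ln (gseries f x) = f 1%N * qlog s x.
Proof.
move=> f0 f01 f1 fr f' f'' ODE s.
have f'0 n : 0 <= f' n by rewrite mulr_ge0.
have f'01 : f' 0%N = f 1%N by rewrite /f' /pseries_diffs mul1r.
have g0 x : 0 <= x < r -> 0 < gseries f x.
  move=> xr; have fx : cvgn (pseries f x) by apply: cvg_pseries_le fr _; lra.
  apply: lt_le_trans (gseries_ge_affine f0 fx _); last by lra.
  by rewrite f01 ltr_wpDr ?ltr01// mulr_ge0//; lra.
have g'0 x : 0 <= x < r -> 0 < gseries f' x.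
  move=> xr.
  have fx : cvgn (pseries f' x) by apply: is_cvg_pseries_diffs fr _.
  apply: lt_le_trans (gseries_ge_affine f'0 fx _); last by lra.
  by rewrite f'01 ltr_wpDr// mulr_ge0//; lra.
have ratio x : 0 <= x < r -> gseries f x / gseries f' x = (1 + s * x) / f 1%N.
  move=> /andP[x0 xr].
  have Dl t : 0 <= t <= x ->
      is_derive t 1 (fun x => gseries f x / gseries f' x) (s / f 1%N).
    move=> /andP[t0 tx]; have tr : 0 <= t < r by lra.
    have D := is_derive_gseries f0 fr tr.
    pose k := (t + r) / 2.
    have f'k : cvgn (pseries f' k).
      by apply: is_cvg_pseries_diffs fr _ => //; rewrite /k; lra.
    have D' : is_derive t 1 (gseries f') (gseries f'' t).
      by apply: is_derive_gseries f'k _ => //; rewrite /k; lra.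
    have g'N0 : gseries f' t != 0 by rewrite gt_eqF// g'0.
    have := is_deriveM D (is_deriveV g'N0 D').
    congr is_derive; rewrite /GRing.scale/= /s -[f 1%N]f'01.
    have := ODE t tr; have : f' 0%N != 0 by rewrite f'01 gt_eqF.
    move: (gseries f t) (gseries f' t) (gseries f'' t) (f' 0%N) (f'' 0%N) g'N0.
    move=> g g' g'' b b' g'N0 bN0 Eb.
    have -> : b' = b ^+ 2 * (g * g'') / g' ^+ 2.
      by rewrite Eb mulfK// expf_neq0.
    by field; rewrite g'N0 bN0.
  have Dr t : 0 <= t <= x ->
      is_derive t 1 (fun x => (1 + s * x) / f 1%N) (s / f 1%N).
    move=> _; apply: (@is_derive_affine _ (fun x => x / f 1%N)).
    have := is_deriveZ (f 1%N)^-1 (is_derive_id (1 + s * t) (1 : R)).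
    rewrite [_ *: 1]mulr1; congr is_derive; apply/funext => y.
    by rewrite mulrC.
  apply: (eq_primitive x0 Dl Dr).
  by rewrite !gseries0 f01 f'01 mulr0 addr0.
have s0 x : 0 <= x < r -> 0 < 1 + s * x.
  move=> xr; have : 0 < (1 + s * x) / f 1%N.
    by rewrite -ratio// divr_gt0// ?g0 ?g'0.
  by rewrite pmulr_lgt0// invr_gt0.
move=> x xr; split; first exact: s0.
have /andP[x0 _] := xr.
have Dl t : 0 <= t <= x ->
    is_derive t 1 (@ln R \o gseries f) (gseries f' t / gseries f t).
  move=> /andP[t0 tx]; have tr : 0 <= t < r by lra.
  have Dln := is_derive1_ln (g0 t tr).
  by rewrite mulrC; exact: is_derive1_comp Dln (is_derive_gseries f0 fr tr).
have Dr t : 0 <= t <= x ->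
    is_derive t 1 (fun x => f 1%N * qlog s x) (gseries f' t / gseries f t).
  move=> /andP[t0 tx]; have tr : 0 <= t < r by lra.
  have -> : gseries f' t / gseries f t = f 1%N * (1 + s * t)^-1.
    by rewrite -invf_div ratio// invf_div.
  have Dq := is_derive_qlog (s0 t tr).
  exact (is_deriveZ (f 1%N) Dq).
apply: (eq_primitive x0 Dl Dr).
by rewrite /= gseries0 f01 ln1 qlog0 mulr0.
Qed.

(** * The relation and the logarithm of the series *)

(** [qlogD] applied to [(p * t + b) * x = (b * x) (+) (h x * t)].  The points in
    question lie in [[0, x]] and [h x <= x] because
    [x * (1 + s * b * x) - p * x = b * x * (1 + s * x) >= 0], where
    [b = 1 - p]; this is where the parameter set has to be an interval. *)
Lemma bone_of_ln_gseries (R : realType) (f : nat -> R) (Theta : set R) (s k : R) :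
  (forall n, 0 <= f n) -> f 0%N = 1 -> is_parameter_set Theta ->
  (forall x, Theta x ->
    [/\ 0 < x, cvgn (pseries f x), 0 < 1 + s * x
      & ln (gseries f x) = k * qlog s x]) ->
  bone_relation f Theta.
Proof.
move=> f0 f01 Theta_param lng p /andP[p0 p1].
have g_at x z : Theta x -> 0 <= z <= x ->
    [/\ 0 < 1 + s * z, 0 < gseries f z & ln (gseries f z) = k * qlog s z].
  move=> Tx /andP[]; rewrite le_eqVlt => /predU1P[<- _|z0 zx].
    by rewrite gseries0 f01 ln1 qlog0 !mulr0 addr0 ltr01.
  have Tz : Theta z by apply: (Theta_param x) => //; rewrite z0.
  have [_ fz sz ->] := lng z Tz; split=> //.
  apply: lt_le_trans (gseries_ge_affine f0 fz (ltW z0)).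
  by rewrite f01 ltr_wpDr// mulr_ge0// ltW.
pose h x := p * x / (1 + s * ((1 - p) * x)).
have h_le x : Theta x -> 0 < h x <= x.
  move=> Tx; have [x0 _ sx _] := lng x Tx.
  have d0 : 0 < 1 + s * ((1 - p) * x) by nra.
  rewrite /h divr_gt0 ?mulr_gt0// ler_pdivrMr//= -subr_ge0.
  have -> : x * (1 + s * ((1 - p) * x)) - p * x = (1 - p) * x * (1 + s * x).
    by ring.
  by rewrite !mulr_ge0 ?subr_ge0// ltW.
exists h; split; first by move=> x Tx; apply: (Theta_param x) => //; exact: h_le.
move=> x t Tx /andP[t0 t1]; have [x0 _ _ _] := lng x Tx.
have /andP[h0 hx] := h_le x Tx.
have shrink b y : 0 < y <= x -> 0 <= b <= 1 -> 0 <= b * y <= x.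
  move=> /andP[y0 yx] /andP[b0 b1].
  by rewrite mulr_ge0 ?(ltW y0)//= (le_trans _ yx)// ler_piMl// ltW.
have [||] := g_at x ((p * t + (1 - p)) * x) => //.
  by apply: shrink; rewrite ?x0 ?lexx//; nra.
have [||] := g_at x ((1 - p) * x) => //.
  by apply: shrink; rewrite ?x0 ?lexx//; lra.
have [||] := g_at x (t * h x) => //.
  by apply: shrink; rewrite ?h0 ?t0.
rewrite [t * _]mulrC.
move=> sht ght lnht sbx gbx lnbx _ gx lnx.
apply: ln_inj; rewrite ?posrE ?mulr_gt0// lnM ?posrE// lnx lnbx lnht.
rewrite -mulrDr -qlogD//; congr (_ * qlog _ _).
by rewrite /h; field; rewrite gt_eqF.
Qed.

(** Below an element [r] of [Theta] the differential equation applies.  At [r]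
    itself the relation for [p = 1/2] and [t = 1] reads
    [g r = g (r / 2) * g (h r)]; as [g (r / 2) > 1], monotonicity of [g] forces
    [h r < r], so that both factors on the right are already known. *)
Lemma ln_gseries_of_bone (R : realType) (f : nat -> R) (Theta : set R) :
  (forall n, 0 <= f n) -> f 0%N = 1 -> 0 < f 1%N ->
  (forall x, Theta x -> 0 < x /\ cvgn (pseries f x)) ->
  bone_relation f Theta ->
  exists s, forall x, Theta x ->
    0 < 1 + s * x /\ ln (gseries f x) = f 1%N * qlog s x.
Proof.
move=> f0 f01 f1 Theta_cvg bone.
pose s := f 1%N - pseries_diffs (pseries_diffs f) 0%N / f 1%N.
exists s => r Tr; have [r0 fr] := Theta_cvg r Tr.
have below x : 0 <= x < r -> 0 < 1 + s * x /\ ln (gseries f x) = f 1%N * qlog s x.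
  apply: ln_gseries_of_ODE => // {}x /andP[x0 xr].
  have p01 : 0 < 1 - x / r <= 1.
    by rewrite subr_gt0 ltr_pdivrMr// mul1r xr gerBl divr_ge0// ltW.
  have [h [hT hE]] := bone _ p01.
  have [h0 fh] := Theta_cvg _ (hT r Tr).
  (* The thinning probability [1 - x / r] is chosen so that [t = 0] corresponds
     to the point [x]. *)
  apply: (gseries_ODE (u := r - x) (h := h r)) => //; first by lra.
    by rewrite subrKC.
  move=> t t01; have := hE r t Tr t01.
  have rN0 : r != 0 by rewrite gt_eqF.
  by congr (gseries f _ = gseries f _ * _); field.
have half01 : 0 < (1 / 2 : R) <= 1 by lra.
have [h [hT hE]] := bone _ half01.
have [h0 fh] := Theta_cvg _ (hT r Tr).
pose x := r / 2; have x_r : 0 <= x < r by rewrite /x; lra.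
have fx : cvgn (pseries f x) by apply: cvg_pseries_le fr _; lra.
have E t : 0 <= t <= 1 -> gseries f (x + x * t) = gseries f x * gseries f (h r * t).
  move=> t01; have := hE r t Tr t01.
  by congr (gseries f _ = gseries f _ * _); rewrite /x; field.
have g_gt1 z : 0 < z -> cvgn (pseries f z) -> 1 < gseries f z.
  move=> z0 fz; apply: lt_le_trans (gseries_ge_affine f0 fz (ltW z0)).
  by rewrite f01 ltrDl mulr_gt0.
have x0 : 0 < x by rewrite /x; lra.
have gx1 := g_gt1 x x0 fx; have gh1 := g_gt1 _ h0 fh.
have Er : gseries f r = gseries f x * gseries f (h r).
  by have := E 1; rewrite !mulr1 -splitr => -> //; lra.
have hr : h r < r.
  rewrite ltNge; apply/negP => rh.
  have : gseries f r <= gseries f (h r) by apply: ler_gseries => //; lra.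
  by rewrite Er; nra.
have [sx lnx] := below x x_r.
have [sh lnh] := below (h r) ltac:(lra).
(* The value of [h r] is read off at [t = 1/2], where all three arguments of
   the series are known to lie below [r]. *)
have hx : x = h r * (1 + s * x).
  have [sh2 lnh2] := below (h r * (1 / 2)) ltac:(lra).
  have [sx2 lnx2] := below (x + x * (1 / 2)) ltac:(rewrite /x; lra).
  have g0 z : 0 < z -> z <= r -> 0 < gseries f z.
    move=> z0 zr; apply: lt_trans (g_gt1 z z0 _) => //.
    by apply: cvg_pseries_le fr _; lra.
  have := E (1 / 2) ltac:(lra) => /(congr1 (@ln R)).
  rewrite lnM ?posrE ?g0 ?lnx ?lnx2 ?lnh2; [|lra..].
  rewrite -mulrDr -qlogD// => /(mulfI (lt0r_neq0 f1)) /qlog_inj => /(_ sx2).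
  have -> : 1 + s * (x + h r * (1 / 2) + s * x * (h r * (1 / 2))) =
    (1 + s * x) * (1 + s * (h r * (1 / 2))) by ring.
  by rewrite mulr_gt0// => /(_ isT); lra.
have rE : r = x + h r + s * x * h r by rewrite {1}[r]splitr -/x {2}hx; ring.
split.
  suff -> : 1 + s * r = (1 + s * x) * (1 + s * h r) by rewrite mulr_gt0.
  by rewrite {1}rE; ring.
rewrite Er lnM ?posrE ?(lt_trans ltr01)// lnx lnh -mulrDr -qlogD//.
by rewrite -rE.
Qed.

(** * Characterization of the bones *)

(* The power series family theta |-> kappa_theta is determined only up to a
   change of scale theta |-> lambda * theta of its parameter (with a_k replaced
   by a_k / lambda ^ k, which keeps a_0 = 1): lambda is that scale. *)
Theorem theorem2 (R : realType)
  (d : measure_display) (E : measurableType d)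
  (nu : probability E R) (nu_diffuse : diffuse nu)
  (a : nat -> R) (Theta : set R) (kappa : R -> probability nat R)
  (Theta_param : is_parameter_set Theta)
  (kappa_NNPS : is_NNPS a Theta kappa)
  (a_canonical : is_canonical a)
  (a1_gt0 : 0 < a 1%N) :
  bone_relation a Theta <->
  exists2 lambda : R, 0 < lambda &
    [\/ forall theta, Theta theta ->
          ln (gseries a theta) = lambda * theta,
        exists2 c : R, 0 < c & forall theta, Theta theta ->
          ln (gseries a theta) = c * ln (1 + lambda * theta)
      | exists2 c : R, 0 < c & forall theta, Theta theta ->
          0 < 1 - lambda * theta /\
          ln (gseries a theta) = - c * ln (1 - lambda * theta)].
Proof.
have [a_ge0 famP] := kappa_NNPS.
have Theta_cvg x : Theta x -> 0 < x /\ cvgn (pseries a x).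
  by move=> /famP[].
split=> [bone | [lambda lambda0 forms]].
  have [s slog] := ln_gseries_of_bone a_ge0 a_canonical a1_gt0 Theta_cvg
    bone.
  have [s0|s0|s0] := ltgtP s 0.
  - exists (- s); first by rewrite oppr_gt0.
    apply: Or33; exists (a 1%N / - s); first by rewrite divr_gt0// oppr_gt0.
    move=> x /slog[sx ->]; rewrite mulNr opprK; split=> //.
    by rewrite /qlog lt_eqF// invrN mulrN opprK mulrAC mulrA.
  - exists s => //; apply: Or32; exists (a 1%N / s); first by rewrite divr_gt0.
    by move=> x /slog[sx ->]; rewrite /qlog gt_eqF// mulrAC mulrA.
  - exists (a 1%N) => //; apply: Or31 => x /slog[_ ->].
    by rewrite /qlog s0 eqxx.
have lambdaN0 : lambda != 0 by rewrite gt_eqF.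
case: forms => [lng | [c c0 lng] | [c c0 lng]].
- apply: (@bone_of_ln_gseries _ _ _ 0 lambda) => // x Tx.
  have [x0 fx] := Theta_cvg x Tx.
  by rewrite mul0r addr0 ltr01 /qlog eqxx lng.
- apply: (@bone_of_ln_gseries _ _ _ lambda (c * lambda)) => // x Tx.
  have [x0 fx] := Theta_cvg x Tx.
  split=> //; first by rewrite ltr_wpDr// ltW// mulr_gt0.
  by rewrite lng// /qlog (negbTE lambdaN0); field.
- apply: (@bone_of_ln_gseries _ _ _ (- lambda) (c * lambda)) => // x Tx.
  have [x0 fx] := Theta_cvg x Tx; have [lx lngx] := lng x Tx.
  split=> //; first by rewrite mulNr.
  by rewrite lngx /qlog oppr_eq0 (negbTE lambdaN0) [- lambda * x]mulNr; field.
Qed.
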